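(* Let $f=\frac1n\sum_{i=1}^n f_i$ where each $f_i:\mathbb{R}^d\to\mathbb{R}$ is differentiable, lower bounded, convex and $L_i$-smooth ($L_i>0$), and set $L_{\max}=\max_{i\in[n]}L_i$. Suppose that $f$ is $\mu$-strongly convex ($\mu>0$), with minimizer $x^*$. Let $0\le\rho\le\frac{1}{L_{\max}}$ and let $\gamma_b>0$ satisfy $\gamma_b\le\frac{1-L_{\max}\rho}{2L_{\max}(1+L_{\max}\rho)}$. Let $(x^t)_{t\ge0}$ be the iterates of stochastic USAM with constant radius $\rho_t=\rho$ and the Stochastic Polyak Scheduler with cap $\gamma_b$ (defined in the context), started at $x^0\in\mathbb{R}^d$. Then $\gamma_t=\gamma_b$ for all $t$, so that the method is USAM with constant step size $\gamma=\gamma_b$, and for all $t\ge0$, $$\mathbb{E}\|x^t-x^*\|^2\le\left(1-\frac{\mu(1-L_{\max}\rho)^2\gamma}{2}\right)^t\|x^0-x^*\|^2+\frac{2\left(2-(1-L_{\max}\rho)^2\right)}{\mu(1-L_{\max}\rho)^2}\,\sigma^2,$$ where $\sigma^2=\mathbb{E}_{S_t}\left[f_{S_t}(x^* )-\ell_{S_t}^*\right]$.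
   Context: $\|\cdot\|$ is the Euclidean norm; $g$ is $L$-smooth if $\|\nabla g(x)-\nabla g(y)\|\le L\|x-y\|$ for all $x,y$; $f$ is $\mu$-strongly convex if $f-\frac\mu2\|\cdot\|^2$ is convex. Fix a mini-batch size $\tau\in\{1,\dots,n\}$. The mini-batches $S_0,S_1,\dots$ are i.i.d., each uniformly distributed over the subsets of $[n]=\{1,\dots,n\}$ of size $\tau$. For $S\subseteq[n]$ with $|S|=\tau$, $f_S=\frac1\tau\sum_{i\in S}f_i$, and $\ell_S^*\in\mathbb{R}$ is a given (deterministic) lower bound of $f_S$, i.e. $\ell_S^*\le f_S(x)$ for all $x$. Stochastic USAM with constant radius $\rho$ and the Stochastic Polyak Scheduler with cap $\gamma_b$: for $t\ge0$, $$e^t=x^t+\rho\nabla f_{S_t}(x^t),\quad \gamma_t=\min\left\{\frac{f_{S_t}(e^t)-\ell_{S_t}^*-\rho\langle\nabla f_{S_t}(e^t),\nabla f_{S_t}(x^t)\rangle}{\|\nabla f_{S_t}(e^t)\|^2},\gamma_b\right\},\quad x^{t+1}=x^t-\gamma_t\nabla f_{S_t}(e^t).$$ Convention: if $\nabla f_{S_t}(e^t)=0$ the quotient is read as $+\infty$, so $\gamma_t=\gamma_b$ and $x^{t+1}=x^t$. Expectation is over $S_0,S_1,\dots$. *)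

(* Defs.v *)
From HB Require Import structures.
From mathcomp Require Import all_boot all_order all_algebra finmap.
From mathcomp Require Import all_classical all_reals all_analysis.

Set Implicit Arguments.
Unset Strict Implicit.
Unset Printing Implicit Defensive.

Import Order.TTheory GRing.Theory Num.Theory.
Import numFieldNormedType.Exports.

Local Open Scope classical_set_scope.
Local Open Scope ring_scope.

Section euclidean.
Context {R : realType} {dim : nat}.
Implicit Types (g : 'rV[R]_dim -> R) (u v x : 'rV[R]_dim).

Definition dotv u v : R := \sum_j u 0 j * v 0 j.

(* The norm `|u| of the library is the sup norm on row vectors, hence this one.
   Both norms give the same topology, so that [differentiable] and 'D_v mean
   the usual notions. *)
Definition enorm u : R := Num.sqrt (dotv u u).

Definition grad g x : 'rV[R]_dim := \row_j 'D_(delta_mx 0 j) g x.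

Definition smooth (L : R) g :=
  forall x y, enorm (grad g x - grad g y) <= L * enorm (x - y).

Definition convex g := convex_function [set: 'rV[R]_dim] g.

Definition strongly_convex (mu : R) g :=
  convex (fun x => g x - mu / 2 * enorm x ^+ 2).

Definition lower_bounded g := exists m, forall x, m <= g x.

Definition minimizer g x := forall y, g x <= g y.

End euclidean.

Definition batch (n tau : nat) := {A : {set 'I_n} | #|A| == tau}.

Section usam.
Context {R : realType} {dim n tau : nat}.
Variable f : 'I_n -> 'rV[R]_dim -> R.
Implicit Types (A : batch n tau) (x : 'rV[R]_dim).

Definition favg x : R := n%:R^-1 * \sum_i f i x.

Definition fbatch A x : R := tau%:R^-1 * \sum_(i in sval A) f i x.

Definition usam_ascent (rho : R) A x := x + rho *: grad (fbatch A) x.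

(* Division by zero is zero in the library, so the convention that the quotient
   is +oo when the gradient vanishes has to be explicit. *)
Definition polyak_step (ell : batch n tau -> R) (rho gamma_b : R) A x : R :=
  let e := usam_ascent rho A x in
  let g := grad (fbatch A) e in
  if g == 0 then gamma_b
  else Num.min
    ((fbatch A e - ell A - rho * dotv g (grad (fbatch A) x)) / enorm g ^+ 2)
    gamma_b.

(* The iterates along a fixed sequence [b] of batches, for a step size that is
   a function of the current batch and the current iterate. *)
Fixpoint usam (rho : R) (step : batch n tau -> 'rV[R]_dim -> R)
    (x0 : 'rV[R]_dim) (b : nat -> batch n tau) (t : nat) : 'rV[R]_dim :=
  if t is t'.+1 then
    let x := usam rho step x0 b t' in
    x - step (b t') x *: grad (fbatch (b t')) (usam_ascent rho (b t') x)
  else x0.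

Definition usam_polyak (ell : batch n tau -> R) (rho gamma_b : R) :=
  usam rho (polyak_step ell rho gamma_b).

Definition usam_const (rho gamma : R) := usam rho (fun _ _ => gamma).

End usam.

(* The L i are positive in all uses, so that the default value 0 is harmless. *)
Definition Lmax {R : realType} {n : nat} (L : 'I_n -> R) : R :=
  \big[Num.max/0]_i L i.

Section batches.
Context {d : measure_display} {Omega : measurableType d} {R : realType}.
Context {n tau : nat}.
Variables (P : probability Omega R) (S : nat -> Omega -> batch n tau).

(* The finite set of batches carries the discrete sigma-algebra. *)
Definition batches_measurable :=
  forall t (B : set (batch n tau)), measurable (S t @^-1` B).

Definition batches_uniform :=
  forall t A, P (S t @^-1` [set A]) = ('C(n, tau)%:R^-1)%:E.

Definition batches_independent :=
  forall (J : {fset nat}) (B : nat -> set (batch n tau)),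
    P (\bigcap_(t in [set` J]) (S t @^-1` B t)) =
    (\prod_(t <- J) P (S t @^-1` B t))%E.

Definition iid_uniform_batches :=
  [/\ batches_measurable, batches_uniform & batches_independent].

End batches.

(* Main.v *)
(** Write [c = Lmax * rho], let [F] be the function of a batch, [e] the ascent
    point, and put [gap = F e - ell - rho <grad F e, grad F x>].  The descent
    inequality based at [e] and the bound [|grad F x|^2 <= 2 Lmax (F x - ell)]
    give [gap >= (1 - c^2) (F x - ell)].  With [|grad F e| <= (1 + c) |grad F x|]
    this yields [gap >= (1 - c) / (2 Lmax (1 + c)) |grad F e|^2], so the cap of
    the scheduler is always active.

    Expanding the square and using convexity at [e] then gives
    [|x+ - x*|^2 <= |x - x*|^2 - gamma (1 - c)^2 (F x - ell)
    + 2 gamma (F x* - ell)].  The mean over the uniform batch replaces [F] by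
    [f], strong convexity turns [f x - f x*] into [mu / 2 |x - x*|^2], and the
    resulting affine recursion is iterated.  Since only finitely many batches
    exist, expectations over the first [t] batches are finite sums over their
    possible histories, and independence splits off the last batch. *)

Require Import Defs.
From HB Require Import structures.
From mathcomp Require Import all_boot all_order all_algebra finmap.
From mathcomp Require Import all_classical all_reals all_analysis.
From mathcomp Require Import measurable_realfun ring lra.

Import Order.TTheory GRing.Theory Num.Theory.
Import numFieldNormedType.Exports.

Local Open Scope classical_set_scope.
Local Open Scope ring_scope.

(** * Euclidean inner product and norm on row vectors *)

Section inner_product.
Context {R : realType} {dim : nat}.
Implicit Types (u v w : 'rV[R]_dim).

Lemma dotvC u v : dotv u v = dotv v u.
Proof. by apply: eq_bigr => j _; rewrite mulrC. Qed.

Lemma dotvDl u v w : dotv (u + v) w = dotv u w + dotv v w.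
Proof. by rewrite -big_split; apply: eq_bigr => j _; rewrite mxE mulrDl. Qed.

Lemma dotvZl a u v : dotv (a *: u) v = a * dotv u v.
Proof. by rewrite mulr_sumr; apply: eq_bigr => j _; rewrite mxE mulrA. Qed.

Lemma dotvNl u v : dotv (- u) v = - dotv u v.
Proof. by rewrite -scaleN1r dotvZl mulN1r. Qed.

Lemma dotvDr u v w : dotv w (u + v) = dotv w u + dotv w v.
Proof. by rewrite !(dotvC w) dotvDl. Qed.

Lemma dotvZr a u v : dotv u (a *: v) = a * dotv u v.
Proof. by rewrite !(dotvC u) dotvZl. Qed.

Lemma dotvNr u v : dotv u (- v) = - dotv u v.
Proof. by rewrite !(dotvC u) dotvNl. Qed.

Definition dotvE := (dotvDl, dotvDr, dotvNl, dotvNr, dotvZl, dotvZr).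

Lemma dotv_ge0 u : 0 <= dotv u u.
Proof. by apply: sumr_ge0 => j _; rewrite -expr2 sqr_ge0. Qed.

Lemma enorm_ge0 u : 0 <= enorm u.
Proof. exact: sqrtr_ge0. Qed.

Lemma enorm_sqr u : enorm u ^+ 2 = dotv u u.
Proof. by rewrite sqr_sqrtr ?dotv_ge0. Qed.

Lemma enormZ a u : enorm (a *: u) = `|a| * enorm u.
Proof.
by rewrite /enorm !dotvE mulrA -expr2 sqrtrM ?sqr_ge0// sqrtr_sqr.
Qed.

Lemma enorm_eq0 u : enorm u = 0 -> u = 0.
Proof.
move=> u0; have /psumr_eq0P u0' : dotv u u = 0 by rewrite -enorm_sqr u0 expr0n.
apply/rowP => j; rewrite mxE; apply/eqP; rewrite -sqrf_eq0 expr2; apply/eqP.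
by apply: u0' => // k _; rewrite -expr2 sqr_ge0.
Qed.

(** Cauchy-Schwarz: the square of [enorm v *: u - enorm u *: v] expands to
    [2 |u| |v| (|u| |v| - <u, v>)], and the positive factor cancels. *)
Lemma dotv_le_enorm u v : dotv u v <= enorm u * enorm v.
Proof.
have [->|u0] := eqVneq u 0.
  by rewrite -(scale0r 0) dotvZl mul0r mulr_ge0 ?enorm_ge0.
have [->|v0] := eqVneq v 0.
  by rewrite -(scale0r 0) dotvZr mul0r mulr_ge0 ?enorm_ge0.
have gt0 w : w != 0 -> 0 < enorm w.
  by move=> w0; rewrite lt0r enorm_ge0 andbT; apply: contra_neq w0 => /enorm_eq0.
have := dotv_ge0 (enorm v *: u - enorm u *: v).
rewrite !dotvE -!enorm_sqr (dotvC v u) => h.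
rewrite -(ler_pM2l (mulr_gt0 (gt0 _ u0) (gt0 _ v0))).
nra.
Qed.

Lemma enormD u v : enorm (u + v) <= enorm u + enorm v.
Proof.
rewrite -(@ler_pXn2r _ 2) ?nnegrE ?addr_ge0 ?enorm_ge0//.
have := dotv_le_enorm u v.
by rewrite enorm_sqr !dotvE -!enorm_sqr (dotvC v u); nra.
Qed.

Lemma enorm_sum (I : Type) (r : seq I) (F : I -> 'rV[R]_dim) :
  enorm (\sum_(i <- r) F i) <= \sum_(i <- r) enorm (F i).
Proof.
elim/big_ind2: _ => // [|x u y v xu yv].
  by rewrite -(scale0r 0) enormZ normr0 mul0r.
exact: le_trans (enormD _ _) (lerD xu yv).
Qed.

End inner_product.

(** * Directional derivatives, the descent inequality and the gradient bound *)

Section smooth_functions.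
Context {R : realType} {dim : nat}.
Variables (g : 'rV[R]_dim -> R) (L : R).
Hypothesis gdiff : forall x, differentiable g x.
Implicit Types (x y h : 'rV[R]_dim).

Lemma derive_grad x h : 'D_h g x = dotv (grad g x) h.
Proof.
rewrite deriveE// {1}(row_sum_delta h) linear_sum; apply: eq_bigr => j _.
by rewrite linearZ mxE deriveE//= mulrC.
Qed.

Lemma is_derive_line x h (t : R) :
  is_derive t (1 : R) (fun s : R => g (x + s *: h)) (dotv (grad g (x + t *: h)) h).
Proof.
rewrite -derive_grad.
(* The difference quotient of [g] at [x + t *: h] in direction [h] is also that of the restriction
   to the line at [t]. *)
pose quot (s : R) : R := s^-1 *: (g (s *: h + (x + t *: h)) - g (x + t *: h)).
have quotE : quot = fun s => s^-1 *: (((fun r : R => g (x + r *: h)) \o shift t)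
    (s *: (1 : R)) - g (x + t *: h)).
  apply/funext => s; rewrite /quot /= [s *: (1 : R)]mulr1 scalerDl.
  by rewrite addrCA.
have dg : derivable g (x + t *: h) h := diff_derivable (gdiff _).
split; first by move: dg; rewrite /derivable -/quot quotE.
by rewrite /derive -/quot quotE.
Qed.

Hypothesis gsmooth : smooth L g.

Lemma descent x y :
  g y <= g x + dotv (grad g x) (y - x) + L / 2 * enorm (y - x) ^+ 2.
Proof.
pose h := y - x.
pose q := dotv (grad g x) h; pose c := enorm h ^+ 2.
(* [g] along the segment minus its quadratic upper model. Smoothness and Cauchy-Schwarz make the
   derivative nonpositive at the mean value point, so [phi 1 <= phi 0], which is the claim. *)
pose phi : R -> R := (fun t => g (x + t *: h)) -
  (q \*: id + (L / 2 * c) \*: (id ^+ 2)).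
have dphi (t : R) : is_derive t (1 : R) phi
    (dotv (grad g (x + t *: h)) h - (q + L * t * c)).
  have dline := is_derive_line x h t.
  by apply: is_derive_eq; rewrite /GRing.scale /=; field.
have cphi : {within `[0, 1], continuous phi}.
  apply: derivable_within_continuous => r _; by have [] := dphi r.
have [z /[!in_itv]/= /andP[z0 _] E] := MVT ltr01 (fun t _ => dphi t) cphi.
have : dotv (grad g (x + z *: h)) h - q <= L * z * c.
  rewrite -dotvNl -dotvDl (le_trans (dotv_le_enorm _ _))// /c expr2 mulrA.
  rewrite ler_wpM2r ?enorm_ge0// (le_trans (gsmooth _ _))//.
  by rewrite addrAC subrr add0r enormZ (gtr0_norm z0) mulrA.
move: E; rewrite /phi !fctE /= scale1r scale0r addr0 subrKC.
rewrite /GRing.scale /= -/h -/q -/c; lra.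
Qed.

(** A gradient step of length [1 / L] lowers [g] by at least [|grad g x|^2 / (2 L)], yet cannot go
    below [m]. *)
Lemma grad_dominated m x : 0 < L -> (forall y, m <= g y) ->
  enorm (grad g x) ^+ 2 <= 2 * L * (g x - m).
Proof.
move=> L0 mg; have := le_trans (mg _) (descent x (x - L^-1 *: grad g x)).
rewrite [x - _ - x]addrAC subrr add0r -scaleNr enormZ dotvZr -enorm_sqr normrN exprMn.
rewrite gtr0_norm ?invr_gt0// => h.
rewrite -ler_pdivrMl ?mulr_gt0//.
suff -> : (2 * L)^-1 * enorm (grad g x) ^+ 2 = L^-1 * enorm (grad g x) ^+ 2
    - L / 2 * (L^-1 ^+ 2 * enorm (grad g x) ^+ 2) by lra.
by field; rewrite gt_eqF.
Qed.

End smooth_functions.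

(** * Convexity inequalities with real coefficients *)

Section convex_functions.
Context {R : realType} {dim : nat}.
Implicit Types (g : 'rV[R]_dim -> R) (x y : 'rV[R]_dim).

Lemma convexP g : convex g <-> forall (t : R) x y, 0 <= t <= 1 ->
  g (t *: x + (1 - t) *: y) <= t * g x + (1 - t) * g y.
Proof.
split=> [cg t x y t01|cg t x y _ _]; last first.
  by rewrite convRE; apply: cg; rewrite ge0 le1.
have := cg (Itv01 (proj1 (andP t01)) (proj2 (andP t01))) x y.
by rewrite convRE; apply; rewrite in_setT.
Qed.

(** The extra term comes from the identity [t |x|^2 + (1 - t) |y|^2 - |t x + (1 - t) y|^2 = t (1 -
    t) |x - y|^2]. *)
Lemma strongly_convexP mu g : strongly_convex mu g -> forall (t : R) x y,
  0 <= t <= 1 -> g (t *: x + (1 - t) *: y) <=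
  t * g x + (1 - t) * g y - mu / 2 * (t * (1 - t)) * enorm (x - y) ^+ 2.
Proof.
move=> /convexP cg t x y /(cg t x y).
rewrite !enorm_sqr !dotvE (dotvC y x); lra.
Qed.

(** Replaces the limit [t -> 0] in the two convexity arguments below. *)
Lemma ler_add_small (a b k : R) : 
  (forall t, 0 < t < 1 -> a <= b + t * k) -> a <= b.
Proof.
move=> h; apply/ler_addgt0Pr => e e0.
have k1 : 0 < `|k| + e + 1 by have := normr_ge0 k; lra.
(* This choice of [t] lies in the open unit interval and satisfies [t * |k| <= e]. *)
have t01 : 0 < e / (`|k| + e + 1) < 1.
  by rewrite divr_gt0//= ltr_pdivrMr// mul1r; have := normr_ge0 k; lra.
apply: le_trans (h _ t01) _; rewrite lerD2l.
have t0 := ltW (proj1 (andP t01)).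
rewrite (le_trans (ler_wpM2l t0 (ler_norm k)))// -mulrA ger_pMr//.
rewrite mulrC ler_pdivrMr// mul1r; lra.
Qed.

(** Compare [g x] with the value at [t *: y + (1 - t) *: x], divide by [t] and let [t] tend to 0. *)
Lemma strongly_convex_growth mu g x y : strongly_convex mu g -> minimizer g x ->
  mu / 2 * enorm (y - x) ^+ 2 <= g y - g x.
Proof.
move=> /strongly_convexP cg gx.
apply: (@ler_add_small _ _ (mu / 2 * enorm (y - x) ^+ 2)) => t /andP[t0 t1].
rewrite -(ler_pM2l t0).
have t01 : 0 <= t <= 1 by rewrite !ltW.
have := le_trans (gx _) (cg t y x t01); lra.
Qed.

(* Convexity on the segment [x, y], combined with descent from [x + t h] back to
   [x], gives the tangent inequality up to an error of order [t]. *)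
Lemma convex_ge_tangent g L x y : (forall z, differentiable g z) ->
  smooth L g -> convex g -> g x + dotv (grad g x) (y - x) <= g y.
Proof.
move=> gdiff gsmooth /convexP cg; pose h := y - x.
apply: (@ler_add_small _ _ (3 / 2 * L * enorm h ^+ 2)) => t /andP[t0 t1].
have t01 : 0 <= t <= 1 by rewrite !ltW.
have := cg t y x t01.
have -> : t *: y + (1 - t) *: x = x + t *: h.
  by rewrite scalerBl scale1r scalerBr addrC addrAC addrA.
have xE : x - (x + t *: h) = (- t) *: h by rewrite opprD addNKr scaleNr.
have := descent _ _ gdiff gsmooth (x + t *: h) x.
have dot_le := dotv_le_enorm (grad g x - grad g (x + t *: h)) h.
have := le_trans dot_le (ler_wpM2r (enorm_ge0 h) (gsmooth x (x + t *: h))).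
rewrite xE !enormZ normrN (gtr0_norm t0) !dotvE -(ler_pM2l t0) exprMn -/h => h1 h2 h3.
rewrite -(ler_pM2l t0); lra.
Qed.

End convex_functions.

(** * Regularity of finite linear combinations *)

Section linear_combinations.
Context {R : realType} {dim n : nat}.
Variables (f : 'I_n -> 'rV[R]_dim -> R) (c : 'I_n -> R).
Implicit Types x y : 'rV[R]_dim.

Let F x := \sum_i c i * f i x.

Let FE : F = \sum_i (c i \*: f i).
Proof. by apply/funext => x; rewrite fct_sumE. Qed.

Hypothesis fdiff : forall i x, differentiable (f i) x.

Lemma differentiable_lincomb x : differentiable F x.
Proof. by rewrite FE; apply: differentiable_sum => i; apply: differentiableZ. Qed.

Lemma grad_lincomb x : grad F x = \sum_i c i *: grad (f i) x.
Proof.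
have df i v : derivable (f i) x v := diff_derivable (fdiff i x).
apply/rowP => j; rewrite mxE FE derive_sum; last first.
  by move=> i; exact: derivableZ.
by rewrite summxE; apply: eq_bigr => i _; rewrite deriveZ// !mxE.
Qed.

Hypothesis c_ge0 : forall i, 0 <= c i.

Lemma smooth_lincomb (L : 'I_n -> R) : (forall i, smooth (L i) (f i)) ->
  smooth (\sum_i c i * L i) F.
Proof.
move=> fsmooth x y; rewrite !grad_lincomb -sumrB mulr_suml.
apply: (le_trans (enorm_sum _ _ _)); apply: ler_sum => i _.
by rewrite -scalerBr enormZ ger0_norm// -mulrA ler_wpM2l// fsmooth.
Qed.

Lemma convex_lincomb : (forall i, convex (f i)) -> convex F.
Proof.
move=> fconv; apply/convexP => t x y t01.
rewrite /F !mulr_sumr -big_split; apply: ler_sum => i _ /=.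
have /convexP /(_ t x y t01) := fconv i.
by move=> /(ler_wpM2l (c_ge0 i)); lra.
Qed.

End linear_combinations.

(** * One USAM step for a single smooth function *)

Section perturbed_step.
Context {R : realType} {dim : nat}.
Variables (g : 'rV[R]_dim -> R) (L ell rho : R) (x : 'rV[R]_dim).
Hypothesis gdiff : forall y, differentiable g y.
Hypothesis gsmooth : smooth L g.
Hypothesis ell_le : forall y, ell <= g y.
Hypothesis L_gt0 : 0 < L.
Hypothesis rho_ge0 : 0 <= rho.
Hypothesis rho_le : L * rho <= 1.

Let e := x + rho *: grad g x.
Let gap := g e - ell - rho * dotv (grad g e) (grad g x).

Lemma perturbed_gap_ge_norm : (1 - (L * rho) ^+ 2) * (g x - ell) <= gap.
Proof.
(* Since [x - e = - rho *: grad g x], the linear term is exactly the correction in [gap]; the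
   quadratic remainder is absorbed by the gradient bound. *)
have := descent _ _ gdiff gsmooth e x.
rewrite /e opprD addNKr -scaleNr enormZ normrN ger0_norm// dotvZr -/e => h1.
have := grad_dominated _ _ gdiff gsmooth ell x L_gt0 ell_le => h2.
have k : 0 <= L * rho ^+ 2 / 2 by rewrite divr_ge0 ?mulr_ge0 ?sqr_ge0// ltW.
have := ler_wpM2l k h2; rewrite /gap exprMn in h1 *; lra.
Qed.

Lemma enorm_perturbed_grad : enorm (grad g e) <= (1 + L * rho) * enorm (grad g x).
Proof.
have -> : grad g e = grad g x + (grad g e - grad g x) by rewrite subrKC.
apply: le_trans (enormD _ _) _; rewrite mulrDl mul1r lerD2l.
apply: le_trans (gsmooth _ _) _.
by rewrite /e addrAC subrr add0r enormZ ger0_norm// mulrA.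
Qed.

Lemma perturbed_gap_ge_sqr :
  (1 - L * rho) / (2 * L * (1 + L * rho)) * enorm (grad g e) ^+ 2 <= gap.
Proof.
apply: le_trans perturbed_gap_ge_norm.
set c := L * rho.
have c0 : 0 <= c by rewrite mulr_ge0// ltW.
have c21 : 0 <= 1 - c ^+ 2 by rewrite subr_ge0 expr_le1.
apply: (@le_trans _ _ ((1 - c ^+ 2) * (enorm (grad g x) ^+ 2 / (2 * L)))); last first.
  rewrite ler_wpM2l// ler_pdivrMr ?mulr_gt0// mulrC.
  exact: grad_dominated.
(* Factoring [1 - c^2 = (1 - c) (1 + c)] and completing [(1 + c)^2] exposes the upper bound on
   [|grad g e|]. *)
have -> : (1 - c ^+ 2) * (enorm (grad g x) ^+ 2 / (2 * L)) =
    (1 - c) / (2 * L * (1 + c)) * ((1 + c) * enorm (grad g x)) ^+ 2.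
  by field; rewrite !gt_eqF//; lra.
rewrite ler_wpM2l ?divr_ge0 ?mulr_ge0 ?subr_ge0 ?addr_ge0 ?(ltW L_gt0)//.
by rewrite ler_sqr ?nnegrE ?mulr_ge0 ?enorm_ge0 ?addr_ge0// enorm_perturbed_grad.
Qed.

(** Convexity at [e] bounds the cross term by [2 gamma (g xstar - ell) - 2 gamma gap]. The squared
    term costs at most [gamma gap] by the cap, so [- gamma gap] remains. *)
Lemma perturbed_step_dist gamma xstar : convex g -> 0 <= gamma ->
  gamma <= (1 - L * rho) / (2 * L * (1 + L * rho)) ->
  enorm (x - gamma *: grad g e - xstar) ^+ 2 <= enorm (x - xstar) ^+ 2
    - gamma * (1 - L * rho) ^+ 2 * (g x - ell) + 2 * gamma * (g xstar - ell).
Proof.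
move=> gconv gamma0 gamma_le.
have c0 : 0 <= L * rho by rewrite mulr_ge0// ltW.
have := convex_ge_tangent _ _ e xstar gdiff gsmooth gconv.
have -> : xstar - e = - (x - xstar) - rho *: grad g x.
  by rewrite /e !opprD opprK addrA (addrC xstar).
have gamma_gap : gamma * enorm (grad g e) ^+ 2 <= gap.
  by apply: le_trans perturbed_gap_ge_sqr; rewrite ler_wpM2r ?sqr_ge0.
(* For [0 <= c <= 1], [(1 - c)^2 <= 1 - c^2]; this weakening produces the factor in the rate. *)
have gap_ge : (1 - L * rho) ^+ 2 * (g x - ell) <= gap.
  apply: le_trans perturbed_gap_ge_norm.
  by rewrite ler_wpM2r ?subr_ge0//; have := ler_wpM2r c0 rho_le; lra.
rewrite (addrAC x) !enorm_sqr !dotvE -!enorm_sqr.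
rewrite (dotvC xstar x) (dotvC xstar (grad g e)) (dotvC x (grad g e)) => h.
have := ler_wpM2l gamma0 gamma_gap.
have := ler_wpM2l gamma0 gap_ge.
have := ler_wpM2l gamma0 h.
rewrite /gap; lra.
Qed.

End perturbed_step.

(** * Counting batches: the mini-batch average is unbiased *)

Section batch_average.
Context {R : realType} {n tau : nat}.

Lemma sum_batch (V : nmodType) (G : {set 'I_n} -> V) :
  \sum_(A : batch n tau) G (val A) = \sum_(B : {set 'I_n} | #|B| == tau) G B.
Proof. by rewrite (big_sub [pred B : {set 'I_n} | #|B| == tau]). Qed.

Lemma card_batch : #|{: batch n tau}| = 'C(n, tau).
Proof.
rewrite -sum1_card (sum_batch _ (fun=> 1%N)) sum1_card -[n in 'C(n, _)]card_ord.
by rewrite -card_draws; apply: eq_card => B; rewrite !inE.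
Qed.

(** The sets that avoid [i] are the [tau]-subsets of its complement; Pascal's rule counts the
    others. *)
Lemma card_draws_mem (i : 'I_n) : (0 < tau)%N ->
  #|[set B : {set 'I_n} | (#|B| == tau) && (i \in B)]%SET| = 'C(n.-1, tau.-1).
Proof.
move=> tau0.
have n0 : (0 < n)%N := leq_ltn_trans (leq0n i) (ltn_ord i).
pose D := [set B : {set 'I_n} | #|B| == tau]%SET.
pose M := [set B : {set 'I_n} | i \in B]%SET.
have DM : #|(D :\: M)%SET| = 'C(n.-1, tau).
  have <- : #|(~: [set i])%SET| = n.-1 by rewrite cardsC1 card_ord.
  rewrite -cards_draws; apply: eq_card => B; rewrite !inE finset.subsetC.
  by rewrite finset.sub1set !inE andbC.
have pascal : 'C(n, tau) = ('C(n.-1, tau.-1) + 'C(n.-1, tau))%N.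
  by rewrite -[in LHS](prednK n0) -(prednK tau0) binS addnC.
have := cardsID M D; rewrite DM card_draws card_ord pascal => /addIn <-.
by apply: eq_card => B; rewrite !inE.
Qed.

(** Double counting: each index lies in ['C(n.-1, tau.-1)] batches, and
    [n 'C(n.-1, tau.-1) = tau 'C(n, tau)]. *)
Lemma sum_fbatch {dim} (f : 'I_n -> 'rV[R]_dim -> R) x : (0 < tau)%N ->
  \sum_(A : batch n tau) fbatch f A x = 'C(n, tau)%:R * favg f x.
Proof.
move=> tau0; rewrite /fbatch -mulr_sumr.
rewrite (sum_batch _ (fun B : {set 'I_n} => \sum_(i in B) f i x)).
rewrite (exchange_big_dep predT)//= /favg mulrA.
under eq_bigr => i _.
  rewrite sumr_const (_ : #|_| = 'C(n.-1, tau.-1)); last first.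
    by rewrite -(card_draws_mem i tau0); apply: eq_card => B; rewrite !inE.
  over.
rewrite sumrMnl -[X in _ * X]mulr_natl mulrA.
have [n0|n0] := posnP n; first by subst n; rewrite !big_ord0 !mulr0.
congr (_ * _); have := mul_bin_diag n tau.-1; rewrite prednK//.
move=> /(congr1 (GRing.natmul (1 : R))); rewrite !natrM => E; apply: (@mulfI _ (tau%:R * n%:R)).
  by rewrite mulf_neq0// pnatr_eq0 -lt0n.
have tau1 : tau%:R != 0 :> R by rewrite pnatr_eq0 -lt0n.
have n1 : n%:R != 0 :> R by rewrite pnatr_eq0 -lt0n.
transitivity (n%:R * 'C(n.-1, tau.-1)%:R : R); first by field.
by rewrite E; field.
Qed.

End batch_average.

(** * Expectations of functions of a finitely valued variable *)

Section expectation_finite_range.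
Context {d : measure_display} {Omega : measurableType d} {R : realType}.
Variable P : probability Omega R.

Lemma expectation_finite (V : finType) (T : Omega -> V) (h : V -> R) :
  (forall v, measurable (T @^-1` [set v])) -> (forall v, 0 <= h v) ->
  ('E_P[fun w => h (T w)] = (\sum_v h v * fine (P (T @^-1` [set v])))%:E)%E.
Proof.
move=> mT h0; rewrite unlock.
under eq_integral => w _.
  (* Split the integrand over the fibres of [T]; nonnegativity then lets the integral pass through
     the sum. *)
  rewrite (_ : (h (T w))%:E =
    (\sum_v (h v)%:E * (\1_(T @^-1` [set v]) w)%:E)%E); last first.
    rewrite (bigD1 (T w))//= big1 => [|v vT].
      by rewrite indicE mem_set// mule1 adde0.
    by rewrite indicE memNset ?mule0// => /= E; rewrite E eqxx in vT.
  over.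
have mI v : measurable_fun setT (fun w => (\1_(T @^-1` [set v]) w : R)%:E).
  exact/measurable_EFinP/measurable_indic.
rewrite ge0_integral_sum//; last 2 first.
- by move=> v; exact: measurable_funeM.
- by move=> v w _; rewrite mule_ge0// lee_fin.
rewrite -sumEFin; apply: eq_bigr => v _.
rewrite ge0_integralZl_EFin// integral_indic// setIT EFinM fineK//.
exact: fin_num_measure.
Qed.

End expectation_finite_range.

(** * Distribution of the first [t] batches *)

Section batch_history.
Context {d : measure_display} {Omega : measurableType d} {R : realType}.
Context {n tau : nat}.
Variables (P : probability Omega R) (S : nat -> Omega -> batch n tau).
Hypothesis hS : iid_uniform_batches P S.

Definition history t w : t.-tuple (batch n tau) :=
  Tuple (introT eqP (size_mkseq (S ^~ w) t)).

Lemma history_rcons t w : history t.+1 w = rcons (history t w) (S t w) :> seq _.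
Proof. exact: mkseqS. Qed.

Definition history_prob t (s : t.-tuple (batch n tau)) : R :=
  fine (P (history t @^-1` [set s])).

(** Puts a history event in the form to which independence applies. [A] is only the default of
    [nth], never reached at indices below [t]. *)
Lemma history_cell t s (A : batch n tau) : history t @^-1` [set s] =
  \bigcap_(i in [set` [fset i | i in iota 0 t]%fset]) (S i @^-1` [set nth A s i]).
Proof.
apply/seteqP; split=> w /=.
  by move=> <- i /=; rewrite !inE mem_iota /= add0n => it; rewrite /= nth_mkseq.
move=> h; apply/val_inj/(@eq_from_nth _ A); rewrite /= size_mkseq ?size_tuple//.
by move=> i it; rewrite nth_mkseq//; apply: h; rewrite /= !inE mem_iota.
Qed.

(* The default value of [nth] supplies the batch [A] at the index [t]. *)
Lemma history_snoc_cell t s (A : batch n tau) :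
  (fun w => (history t w, S t w)) @^-1` [set (s, A)] =
  \bigcap_(i in [set` (t |` [fset i | i in iota 0 t])%fset])
    (S i @^-1` [set nth A s i]).
Proof.
rewrite bigcap_fsetU1 -history_cell nth_default ?size_tuple//.
by apply/seteqP; split=> w /= [-> ->].
Qed.

Lemma measurable_history t s : measurable (history t @^-1` [set s]).
Proof.
(* A nonempty event provides a [w], hence the batch [S 0 w] as a default for [nth]. *)
have [->|/set0P[w _]] := eqVneq (history t @^-1` [set s]) set0; first exact: measurable0.
rewrite (history_cell t s (S 0 w)); apply: fin_bigcap_measurable => // i _.
by case: hS => mS _ _; exact: mS.
Qed.

(** Independence is used twice: to split off the factor at [t], which is uniform, and to reassemble
    the remaining product. *)
Lemma history_prob_snoc t s (A : batch n tau) :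
  fine (P ((fun w => (history t w, S t w)) @^-1` [set (s, A)])) =
  history_prob t s / 'C(n, tau)%:R.
Proof.
case: hS => mS uS iS.
have tJ : t \notin [fset i | i in iota 0 t]%fset by rewrite !inE mem_iota ltnn.
rewrite history_snoc_cell iS big_fsetU1//= -iS -history_cell.
rewrite nth_default ?size_tuple// uS fineM//= 1?mulrC//.
by apply: fin_num_measure => //; exact: measurable_history.
Qed.

Lemma expectation_history t (h : t.-tuple (batch n tau) -> R) :
  (forall s, 0 <= h s) ->
  ('E_P[fun w => h (history t w)] = (\sum_s h s * history_prob t s)%:E)%E.
Proof. by move=> h0; apply: expectation_finite => // s; exact: measurable_history. Qed.

(** The tower property: the inner mean over [A] is the conditional expectation given the past. *)
Lemma expectation_history_snoc t (h : t.-tuple (batch n tau) -> batch n tau -> R) :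
  (forall s A, 0 <= h s A) ->
  ('E_P[fun w => h (history t w) (S t w)] =
   (\sum_s ('C(n, tau)%:R^-1 * \sum_A h s A) * history_prob t s)%:E)%E.
Proof.
move=> h0.
rewrite (expectation_finite P _ (fun w => (history t w, S t w)) (fun v => h v.1 v.2))//.
  rewrite (eq_bigr (fun v => h v.1 v.2 * (history_prob t v.1 / 'C(n, tau)%:R))).
    rewrite -(pair_bigA _ (fun s A => h s A * (history_prob t s / _))) /=.
    congr (_%:E); apply: eq_bigr => s _; rewrite -mulr_suml; ring.
  by move=> [s A] _; rewrite history_prob_snoc.
move=> [s A]; rewrite (_ : _ @^-1` _ = history t @^-1` [set s] `&` S t @^-1` [set A]).
  by apply: measurableI; [exact: measurable_history|case: hS].
by apply/seteqP; split=> w /= [-> ->].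
Qed.

Lemma history_prob_ge0 t s : 0 <= history_prob t s.
Proof. by rewrite fine_ge0. Qed.

Lemma sum_history_prob t : \sum_s history_prob t s = 1.
Proof.
have := expectation_history t (cst 1) (fun=> ler01).
rewrite expectation_cst => -[->].
by apply: eq_bigr => s _; rewrite mul1r.
Qed.

Lemma expectation_batch t (h : batch n tau -> R) : (forall A, 0 <= h A) ->
  ('E_P[fun w => h (S t w)] = ('C(n, tau)%:R^-1 * \sum_A h A)%:E)%E.
Proof.
move=> h0; rewrite (expectation_history_snoc t (fun=> h))//.
by rewrite -mulr_sumr sum_history_prob mulr1.
Qed.

End batch_history.

(** * Regularity of the batch functions and of the full average *)

Section batch_functions.
Context {R : realType} {dim n tau : nat}.
Variables (f : 'I_n -> 'rV[R]_dim -> R) (L : 'I_n -> R).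
Hypothesis fdiff : forall i x, differentiable (f i) x.
Hypothesis fsmooth : forall i, smooth (L i) (f i).
Hypothesis fconv : forall i, convex (f i).

Lemma smooth_le (a b : R) (g : 'rV[R]_dim -> R) : a <= b -> smooth a g -> smooth b g.
Proof.
by move=> ab ga x y; rewrite (le_trans (ga x y))// ler_wpM2r ?enorm_ge0.
Qed.

Lemma ler_Lmax i : L i <= Lmax L.
Proof. exact: le_bigmax. Qed.

Lemma sum_le_Lmax (c : 'I_n -> R) : (forall i, 0 <= c i) -> \sum_i c i = 1 ->
  \sum_i c i * L i <= Lmax L.
Proof.
move=> c0 c1; rewrite -[leRHS]mul1r -c1 mulr_suml.
by apply: ler_sum => i _; rewrite ler_wpM2l ?ler_Lmax.
Qed.

(** Extends the batch average to a convex combination over all indices, the form of the linear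
    combination lemmas. *)
Let weight (A : batch n tau) (i : 'I_n) : R := (i \in sval A)%:R / tau%:R.

Let fbatchE A : fbatch f A = fun x => \sum_i weight A i * f i x.
Proof.
apply/funext => x; rewrite /fbatch big_mkcond mulr_sumr.
by apply: eq_bigr => i _; rewrite /weight; case: ifP => _; rewrite ?mul1r ?mul0r ?mulr0.
Qed.

Let weight_ge0 A i : 0 <= weight A i.
Proof. by rewrite divr_ge0. Qed.

Let sum_weight A : (0 < tau)%N -> \sum_i weight A i = 1.
Proof.
move=> tau0; rewrite -mulr_suml -natr_sum.
rewrite (_ : (\sum_i _)%N = tau) ?divff ?pnatr_eq0 -?lt0n//.
by rewrite -big_mkcond sum1_card; apply/eqP; exact: (valP A).
Qed.

Lemma differentiable_fbatch (A : batch n tau) x : differentiable (fbatch f A) x.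
Proof. by rewrite fbatchE; apply: differentiable_lincomb. Qed.

Lemma smooth_fbatch (A : batch n tau) : (0 < tau)%N -> smooth (Lmax L) (fbatch f A).
Proof.
move=> tau0; rewrite fbatchE.
apply: smooth_le (smooth_lincomb _ _ fdiff (weight_ge0 A) _ fsmooth).
exact: sum_le_Lmax (weight_ge0 A) (sum_weight A tau0).
Qed.

Lemma convex_fbatch (A : batch n tau) : convex (fbatch f A).
Proof. by rewrite fbatchE; apply: convex_lincomb. Qed.

Let favgE : favg f = fun x => \sum_i n%:R^-1 * f i x.
Proof. by apply/funext => x; rewrite /favg mulr_sumr. Qed.

Lemma differentiable_favg x : differentiable (favg f) x.
Proof. by rewrite favgE; apply: differentiable_lincomb. Qed.

Lemma smooth_favg : (0 < n)%N -> smooth (Lmax L) (favg f).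
Proof.
move=> n0; have c0 (i : 'I_n) : 0 <= n%:R^-1 :> R by rewrite invr_ge0.
rewrite favgE; apply: smooth_le (smooth_lincomb _ _ fdiff c0 _ fsmooth).
apply: sum_le_Lmax => //.
by rewrite sumr_const card_ord -[LHS]mulr_natl divff// pnatr_eq0 -lt0n.
Qed.

End batch_functions.

(** Quadratic growth and descent are compared at [x + h] and [x - h]; adding the two cancels the
    gradient term. *)
Lemma strong_convexity_le_smoothness {R : realType} {dim : nat}
    (g : 'rV[R]_dim -> R) (mu L : R) (x y : 'rV[R]_dim) :
  (forall z, differentiable g z) -> smooth L g -> strongly_convex mu g ->
  minimizer g x -> mu * enorm (y - x) ^+ 2 <= L * enorm (y - x) ^+ 2.
Proof.
move=> gdiff gsmooth gstrong gx; pose h := y - x.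
have side z : mu / 2 * enorm (z - x) ^+ 2 <=
    dotv (grad g x) (z - x) + L / 2 * enorm (z - x) ^+ 2.
  have := descent _ _ gdiff gsmooth x z.
  have := strongly_convex_growth _ _ _ z gstrong gx; lra.
have := side (x + h); have := side (x - h).
rewrite !(addrC x) !addrK -/h -scaleN1r enormZ dotvZr normrN1; lra.
Qed.

(** * The active cap and the recursion for the expected distance *)

Section usam_constant_step.
Context {R : realType} {dim n tau : nat}.
Variables (f : 'I_n -> 'rV[R]_dim -> R) (L : 'I_n -> R) (ell : batch n tau -> R).
Variables (mu rho gamma : R) (xstar : 'rV[R]_dim).
Hypothesis tau_bounds : (0 < tau <= n)%N.
Hypothesis fdiff : forall i x, differentiable (f i) x.
Hypothesis fconv : forall i, convex (f i).
Hypothesis L_gt0 : forall i, 0 < L i.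
Hypothesis fsmooth : forall i, smooth (L i) (f i).
Hypothesis ell_le : forall A x, ell A <= fbatch f A x.
Hypothesis rho_bounds : 0 <= rho <= 1 / Lmax L.
Hypothesis gamma_gt0 : 0 < gamma.
Hypothesis gamma_le : gamma <= (1 - Lmax L * rho) / (2 * Lmax L * (1 + Lmax L * rho)).

Let tau_gt0 : (0 < tau)%N. Proof. by case/andP: tau_bounds. Qed.
Let n_gt0 : (0 < n)%N. Proof. by case/andP: tau_bounds; exact: leq_trans. Qed.
Let rho_ge0 : 0 <= rho. Proof. by case/andP: rho_bounds. Qed.
Let Lmax_gt0 : 0 < Lmax L.
Proof. exact: lt_le_trans (L_gt0 (Ordinal n_gt0)) (ler_Lmax _ _). Qed.
Let Lrho_le1 : Lmax L * rho <= 1.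
Proof. by case/andP: rho_bounds => _; rewrite ler_pdivlMr// mulrC. Qed.
Let fbdiff A x := differentiable_fbatch (tau := tau) f fdiff A x.
Let fbsmooth A := smooth_fbatch (tau := tau) f L fdiff fsmooth A tau_gt0.

Lemma polyak_step_cap A x : polyak_step f ell rho gamma A x = gamma.
Proof.
rewrite /polyak_step; case: eqP => // /eqP g0.
apply/min_idPr; rewrite ler_pdivlMr; last first.
  rewrite exprn_gt0// lt0r enorm_ge0 andbT.
  by apply: contra_neq g0 => /enorm_eq0.
apply: le_trans (perturbed_gap_ge_sqr _ _ _ _ _ (fbdiff A) (fbsmooth A)
  (ell_le A) Lmax_gt0 rho_ge0 Lrho_le1).
by rewrite ler_wpM2r ?sqr_ge0.
Qed.

Lemma usam_polyakE x0 b t :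
  usam_polyak f ell rho gamma x0 b t = usam_const f rho gamma x0 b t.
Proof.
rewrite /usam_polyak /usam_const; elim: t => [//|t IH].
by rewrite [LHS]/= [RHS]/= IH polyak_step_cap.
Qed.

Let dist2 (x : 'rV[R]_dim) := enorm (x - xstar) ^+ 2.
Let next x (A : batch n tau) := x - gamma *: grad (fbatch f A) (usam_ascent f rho A x).
Let kappa := (1 - Lmax L * rho) ^+ 2.
Let sigma2 := 'C(n, tau)%:R^-1 * \sum_A (fbatch f A xstar - ell A).

Hypothesis mu_gt0 : 0 < mu.
Hypothesis fstrong : strongly_convex mu (favg f).
Hypothesis xstar_min : minimizer (favg f) xstar.

Let rate := 1 - mu * kappa * gamma / 2.

Let kappa_ge0 : 0 <= kappa.
Proof. exact: sqr_ge0. Qed.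

Lemma mean_step_dist x : 'C(n, tau)%:R^-1 * \sum_A dist2 (next x A) <=
  rate * dist2 x + gamma * (2 - kappa) * sigma2.
Proof.
have N_gt0 : 0 < 'C(n, tau)%:R :> R.
  by rewrite ltr0n bin_gt0; case/andP: tau_bounds.
rewrite ler_pdivrMl//.
(* Writing [F x - ell] as [(F x - F xstar) + (F xstar - ell)] separates the part that averages to
   [f x - f xstar] from the noise, whose coefficient becomes [2 - kappa]. *)
have step A : dist2 (next x A) <= dist2 x
    + gamma * (2 - kappa) * (fbatch f A xstar - ell A)
    - gamma * kappa * (fbatch f A x - fbatch f A xstar).
  have := perturbed_step_dist _ _ _ _ x (fbdiff A) (fbsmooth A)
    (ell_le A) Lmax_gt0 rho_ge0 Lrho_le1 gamma xstar (convex_fbatch f fconv A)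
    (ltW gamma_gt0) gamma_le.
  by rewrite -/(usam_ascent f rho A x) -/(next x A) -/(dist2 _) -/kappa /dist2; lra.
apply: le_trans (ler_sum _ (fun A _ => step A)) _.
have := strongly_convex_growth _ _ _ x fstrong xstar_min; rewrite -/(dist2 x).
set N : R := 'C(n, tau)%:R in N_gt0 *.
rewrite sumrB big_split /= sumr_const card_batch -[_ *+ 'C(n, tau)]mulr_natl.
rewrite -!mulr_sumr [\sum_A (fbatch f A x - _)]sumrB !sum_fbatch// -/N => growth.
have := ler_wpM2l (mulr_ge0 (ltW N_gt0) (mulr_ge0 (ltW gamma_gt0) kappa_ge0)) growth.
have -> : \sum_A (fbatch f A xstar - ell A) = N * sigma2.
  by rewrite /sigma2 mulrA divff ?mul1r ?gt_eqF.
rewrite /rate; lra.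
Qed.

(* The second case only occurs in dimension 0, where [mu <= Lmax L] may fail. *)
Lemma rate_ge0_or_dist2_eq0 : 0 <= rate \/ forall x, dist2 x = 0.
Proof.
have [muL|Lmu] := leP mu (Lmax L); [left|right=> x].
  have c0 : 0 <= Lmax L * rho by rewrite mulr_ge0// ltW.
  have kappa1 : kappa <= 1 by rewrite expr_le1// ?subr_ge0//; lra.
  have := gamma_le; rewrite ler_pdivlMr ?mulr_gt0//; last by lra.
  move=> hg.
  have h1 : gamma * Lmax L <= 1.
    have := mulr_ge0 (ltW (mulr_gt0 gamma_gt0 Lmax_gt0)) c0; lra.
  have h2 : mu * gamma <= 1.
    by apply: le_trans h1; rewrite mulrC ler_wpM2l// ltW.
  have := ler_pM (ltW (mulr_gt0 mu_gt0 gamma_gt0)) kappa_ge0 h2 kappa1.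
  rewrite /rate; lra.
have := strong_convexity_le_smoothness _ _ _ _ x
  (differentiable_favg f fdiff) (smooth_favg f L fdiff fsmooth n_gt0)
  fstrong xstar_min.
rewrite -/(dist2 x) => h; apply/eqP; rewrite eq_le sqr_ge0 andbT.
by rewrite -(pmulr_rle0 _ (_ : 0 < mu - Lmax L)) ?subr_gt0// mulrBl subr_le0.
Qed.

Context {d : measure_display} {Omega : measurableType d}.
Variables (P : probability Omega R) (S : nat -> Omega -> batch n tau).
Hypothesis hS : iid_uniform_batches P S.

Lemma usam_const_history x0 t w :
  usam_const f rho gamma x0 (S ^~ w) t = foldl next x0 (history S t w).
Proof.
rewrite /usam_const; elim: t => [//|t IH].
by rewrite history_rcons foldl_rcons [LHS]/= IH.
Qed.

Lemma expectation_dist2_le x0 t :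
  ('E_P[fun w => dist2 (usam_const f rho gamma x0 (S ^~ w) t)] <=
   (rate ^+ t * dist2 x0 + 2 * (2 - kappa) / (mu * kappa) * sigma2)%:E)%E.
Proof.
have kappa_gt0 : 0 < kappa.
  rewrite exprn_gt0// subr_gt0 lt_neqAle Lrho_le1 andbT.
  (* If [Lmax L * rho = 1], the cap would force [gamma <= 0]. *)
  apply: contraTneq gamma_gt0 => Lrho1; rewrite -leNgt.
  by move: gamma_le; rewrite Lrho1 subrr mul0r.
have kappa_le1 : kappa <= 1.
  have c0 : 0 <= Lmax L * rho by rewrite mulr_ge0// ltW.
  by rewrite expr_le1// ?subr_ge0//; lra.
have sigma2_ge0 : 0 <= sigma2.
  by rewrite mulr_ge0 ?invr_ge0// sumr_ge0// => A _; rewrite subr_ge0.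
set K := 2 * (2 - kappa) / (mu * kappa).
have K_ge0 : 0 <= K * sigma2.
  have kappa_le2 : kappa <= 2 by lra.
  by rewrite mulr_ge0// divr_ge0 ?mulr_ge0 ?subr_ge0 ?(ltW mu_gt0).
have dist2_ge0 x : 0 <= dist2 x by exact: sqr_ge0.
pose E u := \sum_(s : u.-tuple (batch n tau))
  dist2 (foldl next x0 s) * history_prob P S u s.
have EE u : ('E_P[fun w => dist2 (usam_const f rho gamma x0 (S ^~ w) u)] = (E u)%:E)%E.
  under eq_fun do rewrite usam_const_history.
  by rewrite (expectation_history P S hS u (fun s => dist2 (foldl next x0 s))).
have ES u : E u.+1 <= rate * E u + gamma * (2 - kappa) * sigma2.
  suff -> : E u.+1 = \sum_(s : u.-tuple (batch n tau)) ('C(n, tau)%:R^-1 *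
      \sum_A dist2 (next (foldl next x0 s) A)) * history_prob P S u s.
    rewrite -[leRHS](_ : \sum_(s : u.-tuple (batch n tau))
        (rate * dist2 (foldl next x0 s) + gamma * (2 - kappa) * sigma2) * history_prob P S u s = _).
      by apply: ler_sum => s _; rewrite ler_wpM2r ?history_prob_ge0 ?mean_step_dist.
    under eq_bigr do rewrite mulrDl -[rate * _ * _]mulrA.
    by rewrite big_split -!mulr_sumr sum_history_prob// mulr1.
  have E_snoc : (fun w => dist2 (usam_const f rho gamma x0 (S ^~ w) u.+1)) =
      (fun w => dist2 (next (foldl next x0 (history S u w)) (S u w))).
    apply/funext => w.
    by rewrite usam_const_history history_rcons foldl_rcons.
  have := expectation_history_snoc P S hS u
    (fun s A => dist2 (next (foldl next x0 s) A)) (fun s A => dist2_ge0 _).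
  by rewrite -E_snoc EE => -[].
(* [K * sigma2] is the fixed point of the affine recursion, so only the initial distance is damped
   by [rate ^+ t]. *)
have K_fix : rate * (K * sigma2) + gamma * (2 - kappa) * sigma2 = K * sigma2.
  by rewrite /rate /K; field; rewrite !gt_eqF.
(* The induction multiplies its hypothesis by [rate], hence the sign; otherwise all distances vanish
   and the bound is trivial. *)
rewrite EE lee_fin; have [rate_ge0|dist0] := rate_ge0_or_dist2_eq0; last first.
  by rewrite /E big1 ?dist0 ?mulr0 ?add0r// => s _; rewrite dist0 mul0r.
elim: t => [|t IH].
  have foldl0 (s : 0.-tuple (batch n tau)) : foldl next x0 s = x0 by rewrite tuple0.
  rewrite expr0 mul1r /E; under eq_bigr do rewrite foldl0.
  by rewrite -mulr_sumr (sum_history_prob P S hS 0) mulr1 lerDl.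
apply: le_trans (ES t) _; have := ler_wpM2l rate_ge0 IH.
rewrite exprS; lra.
Qed.

End usam_constant_step.

Theorem corollary3p7 (R : realType) (dim n tau : nat)
    (f : 'I_n -> 'rV[R]_dim -> R) (L : 'I_n -> R) (ell : batch n tau -> R)
    (d : measure_display) (Omega : measurableType d) (P : probability Omega R)
    (S : nat -> Omega -> batch n tau)
    (mu rho gamma_b : R) (x0 xstar : 'rV[R]_dim)
    (htau : (0 < tau <= n)%N)
    (hdiff : forall i (x : 'rV[R]_dim), differentiable (f i) x)
    (hlb : forall i, lower_bounded (f i))
    (hconv : forall i, convex (f i))
    (hL : forall i, 0 < L i)
    (hsmooth : forall i, smooth (L i) (f i))
    (hmu : 0 < mu)
    (hstrong : strongly_convex mu (favg f))
    (hxstar : minimizer (favg f) xstar)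
    (hell : forall A x, ell A <= fbatch f A x)
    (hS : iid_uniform_batches P S)
    (hrho : 0 <= rho <= 1 / Lmax L)
    (hgamma_b0 : 0 < gamma_b)
    (hgamma_b : gamma_b <= (1 - Lmax L * rho) /
                           (2 * Lmax L * (1 + Lmax L * rho))) :
  let X t w := usam_polyak f ell rho gamma_b x0 (S ^~ w) t in
  [/\ forall t w, polyak_step f ell rho gamma_b (S t w) (X t w) = gamma_b,
      forall t w, X t w = usam_const f rho gamma_b x0 (S ^~ w) t
    & forall t s : nat,
      ('E_P[fun w => (enorm (X t w - xstar) ^+ 2)%R] <=
       ((1 - mu * (1 - Lmax L * rho) ^+ 2 * gamma_b / 2) ^+ t
          * enorm (x0 - xstar) ^+ 2)%:E
       + (2 * (2 - (1 - Lmax L * rho) ^+ 2)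
            / (mu * (1 - Lmax L * rho) ^+ 2))%:E
         * 'E_P[fun w => (fbatch f (S s w) xstar - ell (S s w))%R])%E].
Proof.
move=> X.
have XE t w : X t w = usam_const f rho gamma_b x0 (S ^~ w) t.
  exact: usam_polyakE htau hdiff hL hsmooth hell hrho hgamma_b x0 _ t.
split=> // [t w|t s].
  exact: polyak_step_cap htau hdiff hL hsmooth hell hrho hgamma_b _ _.
under eq_fun do rewrite XE.
(* For every [s] the noise expectation is the same finite mean, namely the [sigma2] of the
   recursion. *)
rewrite (expectation_batch P S hS s (fun A => fbatch f A xstar - ell A)); last first.
  by move=> A; rewrite subr_ge0.
rewrite -EFinM -EFinD.
exact: (expectation_dist2_le f L).
Qed.
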